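(* Let $\gamma=\gamma(t)$ be a curve immersed in a Kähler manifold $(M,J,g)$ of real dimension $2n$, with Levi-Civita connection $\nabla$. \begin{enumerate} \item The vector field $J(\gamma')$ is an RM vector field along $\gamma$ if and only if $\nabla_{\gamma'(t)}\gamma'(t)=\kappa_{1}(t)J(\gamma'(t))$ for a function $\kappa_1$ along $\gamma$. In this case, if $\kappa_{1}(t)\equiv 0$, then $\gamma$ is a geodesic. \item If $J(\gamma')$ is an RM vector field, then $\nabla_{\gamma'(t)}N_{i}(t)=0$, $i=2,\ldots,2n-1$, for all normal vector fields $N_{i}$, $i=2,\ldots,2n-1$, such that $\{\gamma',J(\gamma'),N_{2},\ldots,N_{2n-1}\}$ is an RMF, i.e., the natural curvatures $\kappa_{2},\ldots,\kappa_{2n-1}$ vanish. \item If $J(\gamma')$ is an RM vector field, then $\|\gamma'(t)\|=\sqrt{g(\gamma'(t),\gamma'(t))}$ is constant. \end{enumerate}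
   Context: Curves and vector fields are smooth. On a Kähler manifold $(M,J,g)$, $J$ is the complex structure, which is $g$-orthogonal and satisfies $\nabla J=0$; $J(\gamma')$ is a normal vector field along $\gamma$. A normal vector field $N$ along an immersed curve $\gamma$ in a Riemannian manifold is called a rotation minimizing (RM) vector field if it is parallel with respect to the normal connection of $\gamma$; equivalently, $\nabla_{\gamma'}N$ is proportional to $\gamma'$. A rotation minimizing frame (RMF) along $\gamma$ in an $m$-dimensional Riemannian manifold is an orthonormal moving frame $\{\gamma',N_1,\ldots,N_{m-1}\}$ along $\gamma$ such that $\nabla_{\gamma'(t)}N_i(t)=-\kappa_i(t)\gamma'(t)$ for $i=1,\ldots,m-1$; the functions $\kappa_i$ are called the natural curvatures. In item 2, $m=2n$ and $N_1=J(\gamma')$. *)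

(* Defs.v *)
From HB Require Import structures.
From mathcomp Require Import all_boot all_order all_algebra.
From mathcomp Require Import all_classical all_reals all_analysis.
Set Implicit Arguments.
Unset Strict Implicit.
Unset Printing Implicit Defensive.
Import Order.TTheory GRing.Theory Num.Theory numFieldNormedType.Exports.
Local Open Scope classical_set_scope.
Local Open Scope ring_scope.

(* C^k and C^oo maps on an open subset of a finite-dimensional space: f is C^(k+1)
   iff it is differentiable and all its directional derivatives are C^k. *)
Fixpoint Ck_on (R : realType) (V W : normedModType R) (k : nat)
    (U : set V) (f : V -> W) : Prop :=
  if k is k'.+1 then
    (forall x, U x -> differentiable f x) /\
    (forall v : V, Ck_on k' U (fun x => 'd f x v))
  else forall x, U x -> {for x, continuous f}.

Definition smooth_on (R : realType) (V W : normedModType R) (U : set V)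
    (f : V -> W) : Prop :=
  forall k, Ck_on k U f.

(* [chart_fun i] is a homeomorphism from the open set [chart_dom i] onto an open
   subset of R^m, with inverse [chart_inv i]; the values of [chart_fun i] and
   [chart_inv i] outside these two sets are irrelevant. *)
Record manifold (R : realType) (m : nat) := Manifold {
  carrier :> topologicalType;
  chart : Type;
  chart_dom : chart -> set carrier;
  chart_fun : chart -> carrier -> 'rV[R]_m;
  chart_inv : chart -> 'rV[R]_m -> carrier;
  manifold_hausdorff : hausdorff_space carrier;
  manifold_second_countable : @second_countable carrier;
  chart_cover : forall p, exists i, chart_dom i p;
  chart_dom_open : forall i, open (chart_dom i);
  chart_img_open : forall i, open (chart_fun i @` chart_dom i);
  chart_funK : forall i p, chart_dom i p -> chart_inv i (chart_fun i p) = p;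
  chart_fun_continuous : forall i p, chart_dom i p ->
    {for p, continuous (chart_fun i)};
  chart_inv_continuous : forall i x, (chart_fun i @` chart_dom i) x ->
    {for x, continuous (chart_inv i)};
  transition_smooth : forall i j,
    smooth_on (chart_fun i @` (chart_dom i `&` chart_dom j))
              (chart_fun j \o chart_inv i)
}.

Definition chart_at (R : realType) (m : nat) (M : manifold R m) (p : M) :
  chart M := projT1 (cid (chart_cover p)).

(* A tangent vector at p is represented by its components in the chart
   [chart_at p]; [coord i p v] are its components in another chart i around p,
   obtained by the usual change of coordinates. *)
Definition tangent (R : realType) (m : nat) (M : manifold R m) (p : M) :
  lmodType R := 'rV[R]_m.

Definition coord (R : realType) (m : nat) (M : manifold R m) (i : chart M)
    (p : M) (v : tangent p) : 'rV[R]_m :=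
  'd (chart_fun i \o chart_inv (chart_at p)) (chart_fun (chart_at p) p) v.

(* The coordinate field d/dx_k of the chart i; meaningful on [chart_dom i]. *)
Definition frame (R : realType) (m : nat) (M : manifold R m) (i : chart M)
    (k : 'I_m) (p : M) : tangent p :=
  'd (chart_fun (chart_at p) \o chart_inv i) (chart_fun i p) (delta_mx 0 k).

Definition vfield (R : realType) (m : nat) (M : manifold R m) :=
  forall p : M, tangent p.

Definition local_rep (R : realType) (m : nat) (M : manifold R m) (i : chart M)
    (X : vfield M) : 'rV[R]_m -> 'rV[R]_m :=
  fun x => coord i (X (chart_inv i x)).

Definition smooth_vfield (R : realType) (m : nat) (M : manifold R m)
    (U : set M) (X : vfield M) : Prop :=
  forall i, smooth_on (chart_fun i @` (chart_dom i `&` U)) (local_rep i X).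

Definition smooth_fun (R : realType) (m : nat) (M : manifold R m)
    (U : set M) (f : M -> R) : Prop :=
  forall i, smooth_on (chart_fun i @` (chart_dom i `&` U)) (f \o chart_inv i).

Definition smooth_vfield_near (R : realType) (m : nat) (M : manifold R m)
    (p : M) (X : vfield M) : Prop :=
  exists U : set M, [/\ open U, U p & smooth_vfield U X].

Definition smooth_fun_near (R : realType) (m : nat) (M : manifold R m)
    (p : M) (f : M -> R) : Prop :=
  exists U : set M, [/\ open U, U p & smooth_fun U f].

(* The derivative u(f) of f along the tangent vector u at p. *)
Definition dirder (R : realType) (m : nat) (M : manifold R m) (p : M)
    (u : tangent p) (f : M -> R) : R :=
  'd (f \o chart_inv (chart_at p)) (chart_fun (chart_at p) p) u.

(* [X, Y] = DY(X) - DX(Y) in coordinates. *)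
Definition lie_bracket (R : realType) (m : nat) (M : manifold R m)
    (X Y : vfield M) : vfield M :=
  fun p => 'd (local_rep (chart_at p) Y) (chart_fun (chart_at p) p) (X p)
         - 'd (local_rep (chart_at p) X) (chart_fun (chart_at p) p) (Y p).

Record riemannian_metric (R : realType) (m : nat) (M : manifold R m) :=
    RiemannianMetric {
  metric :> forall p : M, tangent p -> tangent p -> R;
  metric_linear : forall p (a : R) (u v w : tangent p),
    metric (a *: u + v) w = a * metric u w + metric v w;
  metric_sym : forall p (u v : tangent p), metric u v = metric v u;
  metric_pos : forall p (u : tangent p), u != 0 -> 0 < metric u u;
  metric_smooth : forall (U : set M) (X Y : vfield M), open U ->
    smooth_vfield U X -> smooth_vfield U Y ->
    smooth_fun U (fun p => metric (X p) (Y p))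
}.

(* An affine connection, as an operator on germs of smooth vector fields:
   [nabla p u Y] is the derivative of Y at p in the direction u. Its values on
   fields that are not smooth near p are irrelevant. *)
Record connection (R : realType) (m : nat) (M : manifold R m) := Connection {
  nabla :> forall p : M, tangent p -> vfield M -> tangent p;
  nabla_local : forall p (u : tangent p) (Y Z : vfield M),
    (\forall q \near p, Y q = Z q) -> nabla u Y = nabla u Z;
  nabla_linear : forall p (a : R) (u v : tangent p) (Y : vfield M),
    smooth_vfield_near p Y ->
    nabla (a *: u + v) Y = a *: nabla u Y + nabla v Y;
  nabla_add : forall p (u : tangent p) (Y Z : vfield M),
    smooth_vfield_near p Y -> smooth_vfield_near p Z ->
    nabla u (fun q => Y q + Z q) = nabla u Y + nabla u Z;
  nabla_leibniz : forall p (u : tangent p) (f : M -> R) (Y : vfield M),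
    smooth_fun_near p f -> smooth_vfield_near p Y ->
    nabla u (fun q => f q *: Y q) = dirder u f *: Y p + f p *: nabla u Y;
  nabla_smooth : forall (U : set M) (X Y : vfield M), open U ->
    smooth_vfield U X -> smooth_vfield U Y ->
    smooth_vfield U (fun p => nabla (X p) Y)
}.

Definition torsion_free (R : realType) (m : nat) (M : manifold R m)
    (D : connection M) : Prop :=
  forall (p : M) (X Y : vfield M),
    smooth_vfield_near p X -> smooth_vfield_near p Y ->
    D p (X p) Y - D p (Y p) X = lie_bracket X Y p.

Definition metric_compatible (R : realType) (m : nat) (M : manifold R m)
    (g : riemannian_metric M) (D : connection M) : Prop :=
  forall (p : M) (u : tangent p) (Y Z : vfield M),
    smooth_vfield_near p Y -> smooth_vfield_near p Z ->
    dirder u (fun q => g q (Y q) (Z q)) =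
      g p (D p u Y) (Z p) + g p (Y p) (D p u Z).

Definition levi_civita (R : realType) (m : nat) (M : manifold R m)
    (g : riemannian_metric M) (D : connection M) : Prop :=
  torsion_free D /\ metric_compatible g D.

Definition endofield (R : realType) (m : nat) (M : manifold R m) :=
  forall p : M, {linear tangent p -> tangent p}.

(* (g, J) is a Kaehler structure, D being the Levi-Civita connection of g: J is a
   smooth almost complex structure, g-orthogonal and parallel. Integrability of
   J is not listed separately, since it follows: D is torsion-free, so D J = 0
   makes the Nijenhuis tensor of J vanish. *)
Record kahler (R : realType) (n : nat) (M : manifold R (2 * n))
    (g : riemannian_metric M) (D : connection M) (J : endofield M) : Prop :=
    Kahler {
  kahler_levi_civita : levi_civita g D;
  kahler_smooth : forall (U : set M) (X : vfield M), open U ->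
    smooth_vfield U X -> smooth_vfield U (fun p => J p (X p));
  kahler_sqr : forall p (u : tangent p), J p (J p u) = - u;
  kahler_orthogonal : forall p (u v : tangent p),
    g p (J p u) (J p v) = g p u v;
  kahler_parallel : forall p (u : tangent p) (Y : vfield M),
    smooth_vfield_near p Y ->
    D p u (fun q => J q (Y q)) = J p (D p u Y)
}.

(* Curves are functions on R of which only the values on an open interval I
   matter. *)
Definition velocity (R : realType) (m : nat) (M : manifold R m)
    (gam : R -> M) (t : R) : tangent (gam t) :=
  derive1 (chart_fun (chart_at (gam t)) \o gam) t.

Definition smooth_curve (R : realType) (m : nat) (M : manifold R m)
    (I : set R) (gam : R -> M) : Prop :=
  (forall t, I t -> {for t, continuous gam}) /\
  (forall i, smooth_on (I `&` gam @^-1` chart_dom i) (chart_fun i \o gam)).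

Definition immersed_curve (R : realType) (m : nat) (M : manifold R m)
    (I : set R) (gam : R -> M) : Prop :=
  [/\ open I, is_interval I, smooth_curve I gam &
      forall t, I t -> velocity gam t != 0].

Definition along (R : realType) (m : nat) (M : manifold R m) (gam : R -> M) :=
  forall t : R, tangent (gam t).

Definition smooth_along (R : realType) (m : nat) (M : manifold R m)
    (I : set R) (gam : R -> M) (V : along gam) : Prop :=
  forall i, smooth_on (I `&` gam @^-1` chart_dom i) (fun t => coord i (V t)).

(* The covariant derivative of V = sum_k v_k d/dx_k along gam is
   sum_k (v_k' d/dx_k + v_k nabla_(gam') d/dx_k), computed here at each t in the
   chart [chart_at (gam t)]; any chart around gam t gives the same vector. *)
Definition covD (R : realType) (m : nat) (M : manifold R m)
    (D : connection M) (gam : R -> M) (V : along gam) : along gam :=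
  fun t =>
    let i := chart_at (gam t) in
    let v := fun s => coord i (V s) in
    \sum_(k < m) ((derive1 v t) 0 k *: frame i k (gam t)
                  + v t 0 k *: D (gam t) (velocity gam t) (frame i k)).

Definition geodesic (R : realType) (m : nat) (M : manifold R m)
    (D : connection M) (I : set R) (gam : R -> M) : Prop :=
  forall t, I t -> covD D (velocity gam) t = 0.

Definition normal_along (R : realType) (m : nat) (M : manifold R m)
    (g : riemannian_metric M) (I : set R) (gam : R -> M) (N : along gam) :
  Prop := forall t, I t -> g (gam t) (N t) (velocity gam t) = 0.

Definition normal_part (R : realType) (m : nat) (M : manifold R m)
    (g : riemannian_metric M) (gam : R -> M) (V : along gam) : along gam :=
  fun t => let T := velocity gam t in
    V t - (g (gam t) (V t) T / g (gam t) T T) *: T.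

Definition normal_covD (R : realType) (m : nat) (M : manifold R m)
    (g : riemannian_metric M) (D : connection M) (gam : R -> M)
    (N : along gam) : along gam :=
  normal_part g (covD D N).

Definition rotation_minimizing (R : realType) (m : nat) (M : manifold R m)
    (g : riemannian_metric M) (D : connection M) (I : set R) (gam : R -> M)
    (N : along gam) : Prop :=
  [/\ smooth_along I N, normal_along g I N &
      forall t, I t -> normal_covD g D N t = 0].

(* The moving frame {gam', N 1, ..., N (m-1)} with natural curvatures
   kappa 1, ..., kappa (m-1); the other values of N and kappa are unused. *)
Definition rm_frame (R : realType) (m : nat) (M : manifold R m)
    (g : riemannian_metric M) (D : connection M) (I : set R) (gam : R -> M)
    (N : nat -> along gam) (kappa : nat -> R -> R) : Prop :=
  let E := fun i => if i is 0%N then velocity gam else N i in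
  [/\ forall i, (i < m)%N -> smooth_along I (E i),
      forall i j t, (i < m)%N -> (j < m)%N -> I t ->
        g (gam t) (E i t) (E j t) = (i == j)%:R &
      forall i t, (0 < i < m)%N -> I t ->
        covD D (N i) t = - kappa i t *: velocity gam t].

(* Main.v *)
Require Import Defs.
From HB Require Import structures.
From mathcomp Require Import all_boot all_order all_algebra.
From mathcomp Require Import all_classical all_reals all_analysis.
From mathcomp Require Import ring.
Import Order.TTheory GRing.Theory Num.Theory numFieldNormedType.Exports.
Local Open Scope classical_set_scope.
Local Open Scope ring_scope.
Set Implicit Arguments.
Unset Strict Implicit.

(* Since nabla J = 0, the derivative of J(gam') is J(D gam'), so it is
   proportional to gam' exactly when D gam' is proportional to J(gam'). As
   g(J(gam'), gam') = 0, this kills the derivative 2 g(D gam', gam') of the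
   squared speed, and differentiating g(N_i, gam') = 0 gives
   kappa_i = g(N_i, D gam') = 0 because N_i is orthogonal to J(gam'). The
   covariant derivative along gam being defined in coordinates, nabla J = 0 and
   nabla g = 0 have to be transferred to it through the coordinate frame. *)

(* [vector.coord] shadows the one of [Defs]. *)
Local Notation coord := Defs.coord.

(** * Differentials: dependence on germs, product rule, coordinates *)

Section Differentials.
Context {R : realType}.
Implicit Types V W Z : normedModType R.

(** The first-order expansion of [f] at [x] is also one of [g], since the two agree near [x], and
    such an expansion determines the differential. Chart identities hold only near a point, so every
    chain rule below passes through this lemma. *)
Lemma near_eq_is_diff V W (f g df : V -> W) (x : V) :
  (\near x, f x = g x) -> is_diff x f df -> is_diff x g df.
Proof.
move=> fg [fx <-].
have fgx : f x = g x by exact: nbhs_singleton fg.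
have gE : g \o shift x = cst (g x) + 'd f x +o_ 0 id.
  apply/eqaddoP => e e0; have /eqaddoP/(_ e e0) := diff_locally fx.
  have fg0 : \forall h \near (0 : V), f (h + x) = g (h + x).
    by move: fg; rewrite (near_shift 0) subr0.
  apply: filter_app; apply: filter_app fg0; near=> h => /= fgh.
  rewrite -fgx -![(_ + _ : _ -> _) _]/(_ + _) -![(- _ : _ -> _) _]/(- _).
  by rewrite /= fgh.
have dg : 'd g x = 'd f x :> (V -> W).
  by apply: diff_unique gE; exact: diff_continuous.
split => //; apply/diff_locallyP; rewrite dg; split => //.
exact: diff_continuous.
Unshelve. all: by end_near. Qed.

Lemma near_eq_diff V W (f g : V -> W) (x : V) :
  (\near x, f x = g x) -> differentiable f x -> 'd f x = 'd g x :> (V -> W).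
Proof. by move=> fg /differentiableP/(near_eq_is_diff fg) [_ ->]. Qed.

(** Registers scaling as a bilinear map, so that the differential of a continuous bilinear map
    yields the product rule [is_diff_scale]. *)
Lemma scaler_is_bilinear W :
  bilinear_for
    (GRing.Scale.Law.clone _ _ *:%R _) (GRing.Scale.Law.clone _ _ *:%R _)
    (@GRing.scale R W : R -> W -> W).
Proof.
split=> [u'|u] a x y /=; first by rewrite scalerDl scalerA.
by rewrite scalerDr !scalerA mulrC.
Qed.

HB.instance Definition _ W :=
  bilinear_isBilinear.Build R R W W _ _ (@GRing.scale R W)
  (@scaler_is_bilinear W).

Lemma is_diff_scale V W (f df : V -> R) (g dg : V -> W) (x : V) :
  is_diff x f df -> is_diff x g dg ->
  is_diff x (fun y => f y *: g y) (fun v => f x *: dg v + df v *: g x).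
Proof.
move=> dfx dgx.
have scx (p : R * W) : is_diff p (fun q => q.1 *: q.2)
    (fun q => p.1 *: q.2 + q.1 *: p.2).
  have c : continuous (fun q : R * W => q.1 *: q.2).
    by move=> q; exact: scale_continuous.
  split; first exact: (@differentiable_bilin _ _ _ _ (@GRing.scale R W)).
  by rewrite (@diff_bilin _ _ _ _ (@GRing.scale R W)).
exact: (is_diff_comp (is_diff_pair dfx dgx) (scx (f x, g x))).
Qed.

Lemma is_diff_coord m (i : 'I_m) V (f df : V -> 'rV[R]_m) (x : V) :
  is_diff x f df ->
  is_diff x (fun y => f y 0 i) (fun v => df v 0 i).
Proof.
move=> dfx.
have @L : {linear 'rV[R]_m -> R}.
  by exists (fun N : 'rV[R]_m => N 0 i); do 2![eexists]; do ?[constructor];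
     rewrite ?mxE// => ? *; rewrite ?mxE//; move=> ?; rewrite !mxE.
have cL : continuous L by exact: coord_continuous.
have dL : is_diff (f x) L L.
  by split; [exact: linear_differentiable | exact: diff_lin].
exact: (is_diff_comp dfx dL).
Qed.

Lemma is_derive_is_diff W (f df : R -> W) (x : R) :
  is_diff x f df -> is_derive x 1 f (df 1).
Proof.
move=> [fx <-]; split; first exact: diff_derivable.
by rewrite deriveE.
Qed.

End Differentials.

(** * Closure properties of maps of class C^k on an open set *)

Section CkFunctions.
Context {R : realType}.
Implicit Types V W Z : normedModType R.

(** Openness of [U] turns equality on [U] into equality near each of its points, so the
    differentials agree on [U] and the induction continues with them. *)
Lemma Ck_on_ext V W k (U : set V) (f g : V -> W) : open U ->
  (forall x, U x -> f x = g x) -> Ck_on k U f -> Ck_on k U g.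
Proof.
move=> oU; elim: k f g => [|k IH] f g fg /=.
  move=> cf x Ux; apply: cvg_trans (_ : f @ x --> g x); last first.
    by rewrite -fg//; exact: cf.
  apply: near_eq_cvg; near=> y; apply: fg; near: y; exact: open_nbhs_nbhs.
have nfg x : U x -> \near x, f x = g x.
  by move=> Ux; near=> y; apply: fg; near: y; exact: open_nbhs_nbhs.
move=> [df Cf]; split=> [x Ux|v].
  have [] // := near_eq_is_diff (nfg x Ux) (differentiableP (df x Ux)).
apply: IH (Cf v) => x Ux.
by rewrite (near_eq_diff (nfg x Ux) (df x Ux)).
Unshelve. all: by end_near. Qed.

Lemma Ck_onS V W k (U : set V) (f : V -> W) : Ck_on k.+1 U f -> Ck_on k U f.
Proof.
elim: k f => [|k IH] f.
  by move=> [df _] x Ux; apply: differentiable_continuous; exact: df.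
by move=> [df Cf]; split=> // v; apply: IH; exact: Cf.
Qed.

Lemma Ck_on_cst V W k (U : set V) (c : W) : open U -> Ck_on k U (fun=> c).
Proof.
move=> oU; elim: k c => [|k IH] c /=.
  by move=> x _; exact: cst_continuous.
split=> [x _|v]; first exact: differentiable_cst.
by apply: (Ck_on_ext oU) (IH 0) => x _; rewrite diff_cst.
Qed.

Lemma Ck_onD V W k (U : set V) (f g : V -> W) : open U ->
  Ck_on k U f -> Ck_on k U g -> Ck_on k U (fun x => f x + g x).
Proof.
move=> oU; elim: k f g => [|k IH] f g /=.
  by move=> cf cg x Ux; exact: (cvgD (cf x Ux) (cg x Ux)).
move=> [df Cf] [dg Cg]; split=> [x Ux|v].
  by apply: (@differentiableD _ _ _ f g); [exact: df|exact: dg].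
apply: (Ck_on_ext oU) (IH _ _ (Cf v) (Cg v)) => x Ux.
by rewrite (@diffD _ _ _ f g); [|exact: df|exact: dg].
Qed.

Lemma Ck_on_sum V W (I : Type) (r : seq I) k (U : set V) (f : I -> V -> W) :
  open U -> (forall i, Ck_on k U (f i)) ->
  Ck_on k U (fun x => \sum_(i <- r) f i x).
Proof.
move=> oU Cf; elim: r => [|i r IH].
  by apply: (Ck_on_ext oU) (Ck_on_cst k 0 oU) => x _; rewrite big_nil.
by apply: (Ck_on_ext oU) (Ck_onD oU (Cf i) IH) => x _; rewrite big_cons.
Qed.

(** The product rule gives two products, each with one factor differentiated; [Ck_onS] lowers the
    class of the other factor before the induction hypothesis applies. *)
Lemma Ck_onZ V W k (U : set V) (f : V -> R) (g : V -> W) : open U ->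
  Ck_on k U f -> Ck_on k U g -> Ck_on k U (fun x => f x *: g x).
Proof.
move=> oU; elim: k f g => [|k IH] f g.
  by move=> cf cg x Ux; exact: (cvgZ (cf x Ux) (cg x Ux)).
move=> Cf Cg; move: (Cf) (Cg) => [df Cf'] [dg Cg'].
have dfg x : U x -> is_diff x (fun x => f x *: g x)
    (fun v => f x *: 'd g x v + 'd f x v *: g x).
  move=> Ux; apply: is_diff_scale; apply: differentiableP; [exact: df|].
  exact: dg.
split=> [x /dfg []//|v].
apply: (Ck_on_ext oU) (Ck_onD oU (IH _ _ (Ck_onS Cf) (Cg' v))
  (IH _ _ (Cf' v) (Ck_onS Cg))) => x Ux.
by have [_ ->] := dfg x Ux.
Qed.

Lemma Ck_on_coord V m (i : 'I_m) k (U : set V) (f : V -> 'rV[R]_m) :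
  open U -> Ck_on k U f -> Ck_on k U (fun x => f x 0 i).
Proof.
move=> oU; elim: k f => [|k IH] f.
  move=> cf x Ux; apply: (@continuous_comp _ _ _ f (fun N : 'rV_m => N 0 i)).
    exact: cf.
  exact: coord_continuous.
move=> [df Cf].
have dfi x : U x -> is_diff x (fun x => f x 0 i) (fun v => 'd f x v 0 i).
  by move=> Ux; apply: is_diff_coord; apply: differentiableP; exact: df.
split=> [x /dfi []//|v].
apply: (Ck_on_ext oU) (IH _ (Cf v)) => x Ux.
by have [_ ->] := dfi x Ux.
Qed.

(** In the chain rule the direction ['d f x v] varies with [x], whereas [Ck_on] controls derivatives
    in fixed directions only. Expanding it in the standard basis of the intermediate space gives a
    sum of products of components of ['d f x v] with partial derivatives of [h] composed with [f],
    to which the induction hypothesis applies. *)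
Lemma Ck_on_comp V m Z k (U : set V) (U' : set 'rV[R]_m)
    (f : V -> 'rV[R]_m) (h : 'rV[R]_m -> Z) : open U ->
  (forall x, U x -> U' (f x)) -> Ck_on k U f -> Ck_on k U' h ->
  Ck_on k U (h \o f).
Proof.
move=> oU UU'; elim: k Z h => [|k IH] Z h.
  move=> cf ch x Ux; apply: continuous_comp; first exact: cf.
  by apply: ch; exact: UU'.
move=> Cf Ch; move: (Cf) (Ch) => [df Cf'] [dh Ch'].
split=> [x Ux|v].
  by apply: differentiable_comp; [exact: df|exact/dh/UU'].
have Ck i : Ck_on k U (fun x => 'd f x v 0 i *: 'd h (f x) (delta_mx 0 i)).
  apply: Ck_onZ => //; first by apply: Ck_on_coord => //; exact: Cf'.
  exact: (IH _ (fun y => 'd h y (delta_mx 0 i)) (Ck_onS Cf) (Ch' _)).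
apply: (Ck_on_ext oU) (Ck_on_sum _ oU Ck) => x Ux.
rewrite (@diff_comp _ _ _ _ f h); [|exact: df|exact/dh/UU'] => /=.
rewrite [in RHS](row_sum_delta ('d f x v)) linear_sum /=.
by apply: eq_bigr => i _; rewrite linearZ.
Qed.

End CkFunctions.

(** * Changes of chart, coordinate frames and smooth fields *)

Section Charts.
Context {R : realType} {m : nat} {M : manifold R m}.
Implicit Types (i j k : chart M) (p q : M) (U : set M).

Lemma chart_atP p : chart_dom (chart_at p) p.
Proof. exact: projT2 (cid (chart_cover p)). Qed.

Lemma chart_invP i U x : (chart_fun i @` (chart_dom i `&` U)) x ->
  [/\ chart_dom i (chart_inv i x), U (chart_inv i x)
    & chart_fun i (chart_inv i x) = x].
Proof. by move=> [p [ip Up] <-]; rewrite chart_funK. Qed.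

Lemma open_chart_img i U : open U -> open (chart_fun i @` (chart_dom i `&` U)).
Proof.
move=> oU; rewrite openE => x xiU.
have [ix Ux xE] := chart_invP xiU.
have ix' : (chart_fun i @` chart_dom i) x by exists (chart_inv i x).
have near_img := open_nbhs_nbhs (conj (@chart_img_open _ _ M i) ix').
have near_inv : nbhs x (chart_inv i @^-1` U).
  by apply: (chart_inv_continuous ix'); exact: open_nbhs_nbhs.
apply: filterS2 near_img near_inv => y [q iq <-] /=.
by rewrite chart_funK // => Uq; exists q.
Qed.

Lemma near_chart_fun i p (P : M -> Prop) : chart_dom i p ->
  (\forall q \near p, P q) ->
  \forall x \near chart_fun i p, P (chart_inv i x).
Proof.
move=> ip Pp; apply: chart_inv_continuous; first by exists p.
by rewrite chart_funK.
Qed.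

Lemma near_chart_dom i p : chart_dom i p -> \forall q \near p, chart_dom i q.
Proof. by move=> ip; exact: open_nbhs_nbhs (conj (chart_dom_open i) ip). Qed.

Lemma transition_differentiable i j p : chart_dom i p -> chart_dom j p ->
  differentiable (chart_fun j \o chart_inv i) (chart_fun i p).
Proof.
move=> ip jp; have [+ _] := @transition_smooth _ _ M i j 1%N.
by apply; exists p.
Qed.

(** The cocycle rule for Jacobians of transition maps: the chain rule, applied near [p], where the
    inverse of chart [j] cancels. *)
Lemma diff_transition_comp i j k p v :
  chart_dom i p -> chart_dom j p -> chart_dom k p ->
  'd (chart_fun k \o chart_inv j) (chart_fun j p)
    ('d (chart_fun j \o chart_inv i) (chart_fun i p) v) =
  'd (chart_fun k \o chart_inv i) (chart_fun i p) v.
Proof.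
move=> ip jp kp.
have dij := differentiableP (transition_differentiable ip jp).
have djk : is_diff ((chart_fun j \o chart_inv i) (chart_fun i p))
    (chart_fun k \o chart_inv j)
    ('d (chart_fun k \o chart_inv j) (chart_fun j p)).
  have -> : (chart_fun j \o chart_inv i) (chart_fun i p) = chart_fun j p.
    by rewrite /= chart_funK.
  exact: differentiableP (transition_differentiable jp kp).
have ijk : \forall x \near chart_fun i p,
    ((chart_fun k \o chart_inv j) \o (chart_fun j \o chart_inv i)) x =
    (chart_fun k \o chart_inv i) x.
  apply: (near_chart_fun (P := fun q =>
    chart_fun k (chart_inv j (chart_fun j q)) = chart_fun k q) ip).
  by apply: filterS (near_chart_dom jp) => q jq; rewrite chart_funK.
have [_ E] := near_eq_is_diff ijk (is_diff_comp dij djk).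
exact: esym (congr1 (@^~ v) E).
Qed.

Lemma diff_transition_id i p v : chart_dom i p ->
  'd (chart_fun i \o chart_inv i) (chart_fun i p) v = v.
Proof.
move=> ip.
have iid : \forall x \near chart_fun i p, id x = (chart_fun i \o chart_inv i) x.
  have := open_nbhs_nbhs
    (conj (@chart_img_open _ _ M i) (ex_intro2 _ _ p ip erefl)).
  by apply: filterS => _ [q iq <-] /=; rewrite chart_funK.
have [dx ->//] := near_eq_is_diff iid (is_diff_id _).
Qed.

Lemma coordZ i p a (u : tangent p) : coord i (a *: u) = a *: coord i u.
Proof. exact: linearZ. Qed.

Lemma coord0 i p : coord i (0 : tangent p) = 0.
Proof. exact: linear0. Qed.

Lemma coord_sum i p (A : Type) (r : seq A) (u : A -> tangent p) :
  coord i (\sum_(a <- r) u a) = \sum_(a <- r) coord i (u a).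
Proof. exact: linear_sum. Qed.

(** The vector [frame i a p] is stored in the chart [chart_at p]; the cocycle rule removes this
    intermediate chart, which varies with [p] and would obstruct smoothness arguments. *)
Lemma coord_frame i j (a : 'I_m) p : chart_dom i p -> chart_dom j p ->
  coord j (frame i a p) =
  'd (chart_fun j \o chart_inv i) (chart_fun i p) (delta_mx 0 a).
Proof. by move=> ip jp; exact/diff_transition_comp/jp/chart_atP. Qed.

(** Passing from [chart_at p] to [i] and back is the identity on components. This expansion reduces
    all later claims on vectors along a curve to coordinate fields. *)
Lemma sum_coord_frame i p (v : tangent p) : chart_dom i p ->
  \sum_(a < m) coord i v 0 a *: frame i a p = v.
Proof.
move=> ip; have cp := chart_atP p.
have dE (w : 'rV[R]_m) :
    'd (chart_fun (chart_at p) \o chart_inv i) (chart_fun i p) w =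
    \sum_(a < m) w 0 a *: frame i a p.
  rewrite {1}(row_sum_delta w) linear_sum.
  by apply: eq_bigr => a _; exact: linearZ.
rewrite -dE; apply: etrans (diff_transition_id v cp).
exact: diff_transition_comp.
Qed.

(** In a chart [j] the field is a column of the Jacobian of the transition from [i] to [j],
    precomposed with the transition from [j] to [i]. *)
Lemma smooth_frame i (a : 'I_m) : smooth_vfield (chart_dom i) (frame i a).
Proof.
move=> j k; have oij := open_chart_img (i := j) (chart_dom_open i).
have Ct : Ck_on k (chart_fun i @` (chart_dom i `&` chart_dom j))
    (fun x => 'd (chart_fun j \o chart_inv i) x (delta_mx 0 a)).
  by have [_] := @transition_smooth _ _ M i j k.+1; apply.
apply: (Ck_on_ext oij) (Ck_on_comp oij _ (@transition_smooth _ _ M j i k) Ct).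
  by move=> x /chart_invP [jx ix _]; rewrite /local_rep (coord_frame _ ix jx).
by move=> x /chart_invP [jx ix _]; exists (chart_inv j x).
Qed.

Lemma smooth_vfield_sum (A : Type) (r : seq A) U (X : A -> vfield M) : open U ->
  (forall a, smooth_vfield U (X a)) ->
  smooth_vfield U (fun p => \sum_(a <- r) X a p).
Proof.
move=> oU sX i k; have oiU := open_chart_img (i := i) oU.
apply: (Ck_on_ext oiU) (Ck_on_sum r oiU (fun a => sX a i k)) => x _.
by rewrite /local_rep coord_sum.
Qed.

Lemma smooth_vfieldZ U (f : M -> R) (X : vfield M) : open U ->
  smooth_fun U f -> smooth_vfield U X -> smooth_vfield U (fun p => f p *: X p).
Proof.
move=> oU sf sX i k; have oiU := open_chart_img (i := i) oU.
apply: (Ck_on_ext oiU) (Ck_onZ oiU (sf i k) (sX i k)) => x _.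
by rewrite /local_rep coordZ.
Qed.

(** Smoothness has to be checked in every chart [j], while the components are taken in [i]; the
    transition from [j] to [i] connects the two. *)
Lemma smooth_coord i (X : vfield M) (a : 'I_m) :
  smooth_vfield (chart_dom i) X ->
  smooth_fun (chart_dom i) (fun p => coord i (X p) 0 a).
Proof.
move=> sX j k; have oij := open_chart_img (i := j) (chart_dom_open i).
have Cc : Ck_on k (chart_fun i @` (chart_dom i `&` chart_dom i))
    (fun x => local_rep i X x 0 a).
  by apply: Ck_on_coord (sX i k); exact: open_chart_img (chart_dom_open _).
apply: (Ck_on_ext oij) (Ck_on_comp oij _ (@transition_smooth _ _ M j i k) Cc).
  by move=> x /chart_invP [jx ix _]; rewrite /local_rep /= chart_funK.
by move=> x /chart_invP [jx ix _]; exists (chart_inv j x).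
Qed.

Lemma smooth_vfield_chart_near i p (X : vfield M) : chart_dom i p ->
  smooth_vfield (chart_dom i) X -> smooth_vfield_near p X.
Proof.
by move=> ip sX; exists (chart_dom i); split => //; exact: chart_dom_open.
Qed.

End Charts.

(** * The Leibniz rule for finite sums of vector fields *)

Section NablaSum.
Context {R : realType} {m : nat} {M : manifold R m} (D : connection M).
Context (U : set M) (oU : open U) (p : M) (Up : U p) (u : tangent p).

Lemma nabla0 : D p u (fun q => 0 : tangent q) = 0.
Proof.
have s0 : smooth_vfield_near p (fun q => 0 : tangent q).
  exists U; split => // i k; have oiU := open_chart_img (i := i) oU.
  by apply: (Ck_on_ext oiU) (Ck_on_cst k 0 oiU) => x _; exact/esym/coord0.
(* Additivity applied to 0 + 0 shows that the derivative of the zero field equals its own double. *)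
have D0 : D p u (fun q => 0 + 0 : tangent q) = D p u (fun q => 0 : tangent q).
  by apply: nabla_local; apply: nearW => q; exact: addr0.
have := nabla_add D u s0 s0; rewrite D0.
by move/esym/eqP; rewrite -subr_eq0 addrK => /eqP.
Qed.

Lemma nabla_sum (A : Type) (r : seq A) (f : A -> M -> R) (X : A -> vfield M) :
  (forall a, smooth_fun U (f a)) -> (forall a, smooth_vfield U (X a)) ->
  D p u (fun q => \sum_(a <- r) f a q *: X a q) =
  \sum_(a <- r) (dirder u (f a) *: X a p + f a p *: D p u (X a)).
Proof.
move=> sf sX.
have sfX a : smooth_vfield U (fun q => f a q *: X a q) by exact: smooth_vfieldZ.
elim: r => [|a r IH].
  rewrite big_nil -[RHS]nabla0; apply: nabla_local; apply: nearW => q.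
  by rewrite big_nil.
rewrite big_cons -IH -nabla_leibniz; [|by exists U..].
rewrite -nabla_add; first last.
- by exists U; split => //; exact: smooth_vfield_sum.
- by exists U.
by apply: nabla_local; apply: nearW => q; rewrite big_cons.
Qed.

End NablaSum.

(** * Curves read in charts *)

Section Curves.
Context {R : realType} {m : nat} {M : manifold R m} (I : set R) (gam : R -> M).
Hypotheses (oI : open I) (sgam : smooth_curve I gam).
Local Notation dom i := (I `&` gam @^-1` chart_dom i).

Lemma open_curve_dom (i : chart M) : open (dom i).
Proof.
rewrite openE => t [It it]; apply: filterI; first exact: open_nbhs_nbhs.
by apply: (sgam.1 t It); exact: near_chart_dom.
Qed.

Lemma curve_differentiable (i : chart M) t : I t -> chart_dom i (gam t) ->
  differentiable (chart_fun i \o gam) t.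
Proof. by move=> It it; have [+ _] := sgam.2 i 1%N; apply. Qed.

(** [velocity] is computed in a chart that changes with [t]; the chain rule through a transition map
    expresses it in one fixed chart [i], which gives its smoothness along the curve. *)
Lemma coord_velocity (i : chart M) t : I t -> chart_dom i (gam t) ->
  coord i (velocity gam t) = 'd (chart_fun i \o gam) t 1.
Proof.
move=> It it; have cp := chart_atP (gam t).
have dc := curve_differentiable It cp.
have near_i : \forall s \near t,
    ((chart_fun i \o chart_inv (chart_at (gam t))) \o
     (chart_fun (chart_at (gam t)) \o gam)) s = (chart_fun i \o gam) s.
  have : \forall s \near t, dom (chart_at (gam t)) s.
    by apply: open_nbhs_nbhs; split => //; exact: open_curve_dom.
  by apply: filterS => s [_ cs]; rewrite /= chart_funK.
have [_ ->] := near_eq_is_diff near_i (is_diff_comp (differentiableP dc)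
  (differentiableP (transition_differentiable cp it))).
by rewrite /velocity derive1E'.
Qed.

Lemma smooth_on_curve (i : chart M) (Z : normedModType R)
    (h : 'rV[R]_m -> Z) :
  smooth_on (chart_fun i @` (chart_dom i `&` chart_dom i)) h ->
  smooth_on (dom i) (h \o (chart_fun i \o gam)).
Proof.
move=> sh k; apply: (Ck_on_comp (@open_curve_dom i) _ (sgam.2 i k) (sh k)).
by move=> t [It it]; exists (gam t).
Qed.

Lemma smooth_velocity : smooth_along I (velocity gam).
Proof.
move=> i k; have [_ /(_ 1)] := sgam.2 i k.+1.
apply: Ck_on_ext; first exact: open_curve_dom.
by move=> t [It it]; rewrite coord_velocity.
Qed.

(** The chain rule through [chart_at (gam t)]. It turns the directional derivatives in the axioms of
    a connection into ordinary derivatives in [t]. *)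
Lemma is_derive_fun_curve (f : M -> R) t : I t ->
  smooth_fun (chart_dom (chart_at (gam t))) f ->
  is_derive t 1 (f \o gam) (dirder (velocity gam t) f).
Proof.
move=> It sf; have cp := chart_atP (gam t).
have dc := curve_differentiable It cp.
have df : differentiable (f \o chart_inv (chart_at (gam t)))
    (chart_fun (chart_at (gam t)) (gam t)).
  by have [+ _] := sf (chart_at (gam t)) 1%N; apply; exists (gam t).
have near_f : \forall s \near t, ((f \o chart_inv (chart_at (gam t))) \o
    (chart_fun (chart_at (gam t)) \o gam)) s = (f \o gam) s.
  have : \forall s \near t, dom (chart_at (gam t)) s.
    by apply: open_nbhs_nbhs; split => //; exact: open_curve_dom.
  by apply: filterS => s [_ cs]; rewrite /= chart_funK.
have := is_derive_is_diff (near_eq_is_diff near_f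
  (is_diff_comp (differentiableP dc) (differentiableP df))).
by rewrite /dirder /velocity derive1E'.
Qed.

Lemma is_derive_coord (V : along gam) (a : 'I_m) (i : chart M) t :
  smooth_along I V -> I t -> chart_dom i (gam t) ->
  is_derive t 1 (fun s => coord i (V s) 0 a)
    (derive1 (fun s => coord i (V s)) t 0 a).
Proof.
move=> sV It it; have dV : differentiable (fun s => coord i (V s)) t.
  by have [+ _] := sV i 1%N; apply.
rewrite derive1E' //.
exact: (is_derive_is_diff (is_diff_coord a (differentiableP dV))).
Qed.

End Curves.

Lemma is_derive_fsum (R : realType) (A : Type) (r : seq A) (f : A -> R -> R)
    (df : A -> R) (t : R) :
  (forall a, is_derive t 1 (f a) (df a)) ->
  is_derive t 1 (fun s => \sum_(a <- r) f a s) (\sum_(a <- r) df a).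
Proof.
move=> dfa; elim: r => [|a r IH].
  rewrite big_nil; have := is_derive_cst (0 : R) t 1; congr is_derive.
  by apply/funext => s; rewrite big_nil.
rewrite big_cons; have := is_deriveD (dfa a) IH; congr is_derive.
by apply/funext => s; rewrite big_cons.
Qed.

(** * Bilinearity of the metric *)

Section MetricAlgebra.
Context {R : realType} {m : nat} {M : manifold R m} (g : riemannian_metric M).
Implicit Types p : M.

Lemma metricDl p (u v w : tangent p) : g p (u + v) w = g p u w + g p v w.
Proof. by have := metric_linear g 1 u v w; rewrite scale1r mul1r. Qed.

Lemma metric0l p (w : tangent p) : g p 0 w = 0.
Proof.
by have := metric_linear g (-1) 0 0 w; rewrite scaler0 addr0 mulN1r addNr.
Qed.

Lemma metricZl p a (u w : tangent p) : g p (a *: u) w = a * g p u w.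
Proof.
by have := metric_linear g a u 0 w; rewrite addr0 metric0l addr0.
Qed.

Lemma metricNl p (u w : tangent p) : g p (- u) w = - g p u w.
Proof. by rewrite -scaleN1r metricZl mulN1r. Qed.

Lemma metric_suml p (A : Type) (r : seq A) (u : A -> tangent p)
    (w : tangent p) :
  g p (\sum_(a <- r) u a) w = \sum_(a <- r) g p (u a) w.
Proof.
by elim: r => [|a r IH]; rewrite ?big_nil ?metric0l// !big_cons metricDl IH.
Qed.

Lemma metric_sumr p (A : Type) (r : seq A) (u : A -> tangent p)
    (w : tangent p) :
  g p w (\sum_(a <- r) u a) = \sum_(a <- r) g p w (u a).
Proof.
rewrite Defs.metric_sym metric_suml; apply: eq_bigr => a _.
exact: Defs.metric_sym.
Qed.

Lemma metricDr p (u v w : tangent p) : g p w (u + v) = g p w u + g p w v.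
Proof. by rewrite Defs.metric_sym metricDl !(Defs.metric_sym g _ w). Qed.

Lemma metricZr p a (u w : tangent p) : g p w (a *: u) = a * g p w u.
Proof. by rewrite Defs.metric_sym metricZl Defs.metric_sym. Qed.

End MetricAlgebra.

(** * Metric compatibility of the covariant derivative along a curve *)

Section CovariantDerivative.
Context {R : realType} {m : nat} {M : manifold R m} (D : connection M).
Context (I : set R) (gam : R -> M) (oI : open I) (sgam : smooth_curve I gam).

(** In the chart at [gam t], the function is the sum of [v a * w b * G a b] near [t], with [G] the
    Gram matrix of the coordinate fields. The product rule handles the components, and compatibility
    of the connection with the metric, applied to coordinate fields, handles [G]. *)
Lemma is_derive_metric_along (g : riemannian_metric M) (V W : along gam) t :
  metric_compatible g D -> smooth_along I V -> smooth_along I W -> I t ->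
  is_derive t 1 (fun s => g (gam s) (V s) (W s))
    (g (gam t) (covD D V t) (W t) + g (gam t) (V t) (covD D W t)).
Proof.
move=> gD sV sW It.
pose i := chart_at (gam t); have it : chart_dom i (gam t) by exact: chart_atP.
pose v a s : R := coord i (V s) 0 a.
pose v' a : R := derive1 (fun s => coord i (V s)) t 0 a.
pose w a s : R := coord i (W s) 0 a.
pose w' a : R := derive1 (fun s => coord i (W s)) t 0 a.
pose T := velocity gam t.
pose G a b (q : M) := g q (frame i a q) (frame i b q).
have dG a b : is_derive t 1 (G a b \o gam)
    (g (gam t) (D _ T (frame i a)) (frame i b (gam t))
     + g (gam t) (frame i a (gam t)) (D _ T (frame i b))).
  rewrite -gD; [|exact: smooth_vfield_chart_near it (smooth_frame i _)..].
  apply: (is_derive_fun_curve oI sgam) => //.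
  exact: (metric_smooth g (chart_dom_open i) (smooth_frame i a)
    (smooth_frame i b)).
have dv a : is_derive t 1 (v a) (v' a) by exact: (is_derive_coord a _ It it).
have dw a : is_derive t 1 (w a) (w' a) by exact: (is_derive_coord a _ It it).
have near_g : \forall s \near t,
    \sum_(a < m) \sum_(b < m) v a s * w b s * G a b (gam s) =
    g (gam s) (V s) (W s).
  have : \forall s \near t, (I `&` gam @^-1` chart_dom i) s.
    by apply: open_nbhs_nbhs; split => //; exact: open_curve_dom.
  apply: filterS => s [_ ims].
  rewrite -[in RHS](sum_coord_frame (V s) ims).
  rewrite -[in RHS](sum_coord_frame (W s) ims).
  rewrite metric_suml; apply: eq_bigr => a _.
  rewrite metric_sumr; apply: eq_bigr => b _.
  by rewrite metricZl metricZr mulrA.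
apply: (near_eq_is_derive near_g).
have dS := is_derive_fsum (index_enum 'I_m) (fun a => is_derive_fsum
  (index_enum 'I_m) (fun b => is_deriveM (is_deriveM (dv a) (dw b)) (dG a b))).
apply: is_derive_eq dS _.
rewrite -[in RHS](sum_coord_frame (V t) it) -[in RHS](sum_coord_frame (W t) it).
rewrite /covD -/i !metric_suml -big_split; apply: eq_bigr => a _ /=.
rewrite !metric_sumr -big_split; apply: eq_bigr => b _ /=.
rewrite -/T -/(v' a) -/(w' b) -/(v a t) -/(w b t) /=.
rewrite !(metricDl, metricDr, metricZl, metricZr) /G /=.
(* The product rule is stated with scalings; they are converted to multiplications for [ring]. *)
rewrite -[LHS]/(v a t * w b t * _ + _ * (v a t * w' b + w b t * v' a)).
by ring.
Qed.

End CovariantDerivative.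

(** * The complex structure along a curve *)

Section Kahler.
Context {R : realType} {n : nat} {M : manifold R (2 * n)}.
Context {g : riemannian_metric M} {D : connection M} {J : endofield M}.
Context (HK : kahler g D J).
Context (I : set R) (gam : R -> M) (oI : open I) (sgam : smooth_curve I gam).

Lemma smooth_J_frame (i : chart M) (a : 'I_(2 * n)) :
  smooth_vfield (chart_dom i) (fun q => J q (frame i a q)).
Proof.
by apply: (kahler_smooth HK); [exact: chart_dom_open|exact: smooth_frame].
Qed.

(** Smoothness of [J] is given for fields on open sets of [M], so it is used on the coordinate
    fields: [J V] is the combination of the fields [J (frame i a)], restricted to the curve, with
    the components of [V] as coefficients. *)
Lemma smooth_along_J (V : along gam) : smooth_along I V ->
  smooth_along I (fun t => J (gam t) (V t)).
Proof.
move=> sV i k; have odi := open_curve_dom oI sgam (i := i).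
have CA a : Ck_on k (I `&` gam @^-1` chart_dom i)
    (fun t => coord i (V t) 0 a *:
      (local_rep i (fun q => J q (frame i a q)) \o (chart_fun i \o gam)) t).
  apply: Ck_onZ => //; first by apply: Ck_on_coord => //; exact: sV.
  by apply: smooth_on_curve => //; exact: smooth_J_frame.
apply: (Ck_on_ext odi) (Ck_on_sum (index_enum 'I_(2 * n)) odi CA) => t [_ it].
rewrite -[in RHS](sum_coord_frame (V t) it) linear_sum coord_sum.
apply: eq_bigr => a _.
by rewrite linearZ coordZ /local_rep /= chart_funK.
Qed.

(** With [A a b] the matrix of [J] in the coordinate frame, both sides become double sums over [a]
    and [b]. They agree term by term once the derivative of [A] along the curve is tied to the
    connection by parallelism of [J] on the coordinate fields. *)
Lemma covD_J (V : along gam) t : smooth_along I V -> I t ->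
  covD D (fun s => J (gam s) (V s)) t = J (gam t) (covD D V t).
Proof.
move=> sV It; have sJV := smooth_along_J sV.
pose i := chart_at (gam t); have it : chart_dom i (gam t) by exact: chart_atP.
pose v a s : R := coord i (V s) 0 a.
pose v' a : R := derive1 (fun s => coord i (V s)) t 0 a.
pose T := velocity gam t.
pose A a b (q : M) := coord i (J q (frame i a q)) 0 b.
have sA a b : smooth_fun (chart_dom i) (A a b).
  by apply: smooth_coord; exact: smooth_J_frame.
have JE a q : chart_dom i q ->
    \sum_b A a b q *: frame i b q = J q (frame i a q).
  by move=> iq; exact: sum_coord_frame.
have coordJ s : chart_dom i (gam s) -> forall b,
    \sum_a v a s * A a b (gam s) = coord i (J (gam s) (V s)) 0 b.
  move=> ims b; rewrite -[in RHS](sum_coord_frame (V s) ims) linear_sum.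
  rewrite coord_sum summxE; apply: eq_bigr => a _.
  by rewrite linearZ coordZ mxE.
(* Parallelism turns the left side into the derivative of the field [J (frame i a)], which is then
   expanded by the Leibniz rule. *)
have DJ a : J (gam t) (D _ T (frame i a)) =
    \sum_b (dirder T (A a b) *: frame i b (gam t)
            + A a b (gam t) *: D _ T (frame i b)).
  rewrite -(kahler_parallel HK); last first.
    exact: smooth_vfield_chart_near it (smooth_frame i a).
  rewrite -(nabla_sum D (chart_dom_open i) it) //; last first.
    by move=> b; exact: smooth_frame.
  apply: nabla_local; apply: filterS (near_chart_dom it) => q iq.
  by rewrite JE.
have dJV b : derive1 (fun s => coord i (J (gam s) (V s))) t 0 b =
    \sum_a (v a t * dirder T (A a b) + A a b (gam t) * v' a).
  have [_ <-] := is_derive_coord b sJV It it.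
  have near_J : \forall s \near t,
      \sum_a v a s * A a b (gam s) = coord i (J (gam s) (V s)) 0 b.
    have : \forall s \near t, (I `&` gam @^-1` chart_dom i) s.
      by apply: open_nbhs_nbhs; split => //; exact: open_curve_dom.
    by apply: filterS => s [_ /coordJ].
  have dv a : is_derive t 1 (v a) (v' a) by exact: (is_derive_coord a _ It it).
  have dA a : is_derive t 1 (A a b \o gam) (dirder T (A a b)).
    exact: (is_derive_fun_curve oI sgam).
  have [_ //] := near_eq_is_derive near_J
    (is_derive_fsum (index_enum 'I_(2 * n))
      (fun a => is_deriveM (dv a) (dA a))).
rewrite /covD -/i linear_sum.
under eq_bigr => b _ do rewrite dJV -coordJ// !scaler_suml -big_split /=.
(* The left side sums over the components [b] of [J V] first; exchanging the sums matches the right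
   side, indexed by the components [a] of [V]. *)
rewrite exchange_big; apply: eq_bigr => a _ /=.
rewrite linearD !linearZ /= -/T DJ -JE// !scaler_sumr -big_split /=.
apply: eq_bigr => b _.
rewrite -/(v' a) -/(v a t) scalerDl scalerDr !scalerA [v' a * _]mulrC.
by rewrite [X in X + _ = _]addrC -addrA.
Qed.

End Kahler.

(** The mean value theorem on the segment between the two points, which lies in [I]. *)
Lemma is_derive0_interval_cst (R : realType) (I : set R) (f : R -> R) :
  is_interval I -> (forall t, I t -> is_derive t 1 f 0) ->
  forall a b, I a -> I b -> f a = f b.
Proof.
move=> itvI df.
suff le_cst a b : a <= b -> I a -> I b -> f a = f b.
  move=> a b Ia Ib.
  by case: (leP a b) => [|/ltW] ab; [|symmetry]; exact: le_cst.
move=> ab Ia Ib; have Iab x : x \in `[a, b]%R -> I x.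
  by rewrite in_itv /=; exact: itvI.
have [||c _] := @MVT_segment _ f (fun=> 0) _ _ ab.
- by move=> x xab; apply: df; apply: Iab; exact: subset_itv_oo_cc.
- by apply: derivable_within_continuous => x /Iab /df [].
by rewrite mul0r => /subr0_eq.
Qed.

(** * Rotation minimizing [J(gam')]: the three claims *)

Section KahlerCurve.
Context {R : realType} {n : nat} {M : manifold R (2 * n)}.
Context {g : riemannian_metric M} {D : connection M} {J : endofield M}.
Context (HK : kahler g D J).
Context {I : set R} {gam : R -> M} (Hgam : immersed_curve I gam).
Local Notation T := (velocity gam).
Local Notation JT := (fun t => J (gam t) (velocity gam t)).

(** Orthogonality and [J^2 = -1] give g(Ju, u) = g(JJu, Ju) = - g(u, Ju), so by symmetry the value
    is its own opposite. *)
Lemma metric_J_self p (u : tangent p) : g p (J p u) u = 0.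
Proof.
have : g p (J p u) u = - g p (J p u) u.
  rewrite -{1}(kahler_orthogonal HK) (kahler_sqr HK) metricNl.
  by rewrite (Defs.metric_sym g u).
by move/esym/eqP; rewrite eqNr => /eqP.
Qed.

Lemma metric_velocity_gt0 t : I t -> 0 < g (gam t) (T t) (T t).
Proof. by case: Hgam => _ _ _ T0 It; apply: metric_pos; exact: T0. Qed.

Lemma covD_J_velocity t : I t -> covD D JT t = J (gam t) (covD D T t).
Proof.
case: Hgam => oI _ sgam _.
exact: (covD_J HK oI sgam (smooth_velocity oI sgam)).
Qed.

Lemma rotation_minimizing_J_covD : rotation_minimizing g D I JT ->
  exists kappa : R -> R, forall t, I t -> covD D T t = kappa t *: JT t.
Proof.
move=> [_ _ RM].
(* If J(D gam') = c gam', with c the tangential coefficient in [normal_part], then applying [J]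
   gives - D gam' = c J(gam'); hence the value - c. *)
exists (fun t => - (g (gam t) (covD D JT t) (T t) / g (gam t) (T t) (T t))).
move=> t It; have /subr0_eq := RM t It; set c := _ / _.
rewrite covD_J_velocity// => /(congr1 (J (gam t))).
by rewrite (kahler_sqr HK) linearZ scaleNr /= => <-; rewrite opprK.
Qed.

Lemma covD_rotation_minimizing_J (kappa : R -> R) :
  (forall t, I t -> covD D T t = kappa t *: JT t) ->
  rotation_minimizing g D I JT.
Proof.
case: Hgam => oI _ sgam _ DT; split=> [|t _|t It].
- exact: (smooth_along_J HK oI sgam (smooth_velocity oI sgam)).
- exact: metric_J_self.
(* Here D J(gam') = - kappa gam' is tangential, and its projection coefficient is exactly - kappa
   because the squared speed is nonzero. *)
rewrite /normal_covD /normal_part covD_J_velocity// DT// linearZ /=.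
rewrite (kahler_sqr HK) scalerN metricNl metricZl mulNr mulfK ?scaleNr ?subrr//.
by rewrite gt_eqF// metric_velocity_gt0.
Qed.

Lemma rotation_minimizing_J_speed : rotation_minimizing g D I JT ->
  exists c : R, forall t, I t -> g (gam t) (T t) (T t) = c.
Proof.
move=> /rotation_minimizing_J_covD [kappa DT].
case: (Hgam) => oI itvI sgam _; have sT := smooth_velocity oI sgam.
(* The interval may be empty, in which case any constant serves; otherwise the constant is the
   squared speed at some [t0]. *)
have [[t0 It0]|I0] := pselect (exists t, I t); last first.
  by exists 0 => t It; case: I0; exists t.
exists (g (gam t0) (T t0) (T t0)) => t It.
apply: (is_derive0_interval_cst (f := fun t => g (gam t) (T t) (T t)) itvI);
  [move=> s Is|exact: It|exact: It0].
have [_ gD] := kahler_levi_civita HK.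
apply: is_derive_eq (is_derive_metric_along oI sgam gD sT sT Is) _.
rewrite (Defs.metric_sym g (T s)) DT// metricZl metric_J_self mulr0.
by rewrite addr0.
Qed.

Lemma rotation_minimizing_J_frame (N : nat -> along gam)
    (kappa : nat -> R -> R) :
  rotation_minimizing g D I JT -> (forall t, I t -> N 1%N t = JT t) ->
  rm_frame g D I N kappa ->
  forall i t, (2 <= i < 2 * n)%N -> I t -> covD D (N i) t = 0 /\ kappa i t = 0.
Proof.
move=> /rotation_minimizing_J_covD [k DT] N1 [sE oE DN] i t /andP[i2 in2] It.
case: (Hgam) => oI itvI sgam _; have sT := smooth_velocity oI sgam.
have i0 : (0 < i)%N by exact: ltn_trans i2.
have n0 : (0 < 2 * n)%N by exact: leq_ltn_trans in2.
have n1 : (1 < 2 * n)%N by exact: ltn_trans in2.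
have sN : smooth_along I (N i).
  (* Destructing the positive index reduces the match by which [rm_frame] puts the velocity at index
     0. *)
  by have := sE i in2; case: (i) i0.
have NT s : I s -> g (gam s) (N i s) (T s) = 0.
  by move=> Is; have := oE i 0%N s in2 n0 Is; case: (i) i0.
have NJT : g (gam t) (N i t) (JT t) = 0.
  by have := oE i 1%N t in2 n1 It; rewrite -N1//; case: (i) i2 => [|[|]].
have TT : g (gam t) (T t) (T t) = 1 by exact: (oE 0%N 0%N t n0 n0 It).
have DNi : covD D (N i) t = - kappa i t *: T t by apply: DN => //; rewrite i0.
have [_ gD] := kahler_levi_civita HK.
have [_] := is_derive_metric_along oI sgam gD sN sT It.
have near0 : \forall s \near t, 0 = g (gam s) (N i s) (T s).
  have : \forall s \near t, I s by exact: open_nbhs_nbhs.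
  by apply: filterS => s /NT.
(* The derivative of g(N_i, gam') is 0 on the left. On the right, unit speed turns the first term
   into - kappa_i, and orthogonality of N_i to J(gam') cancels the second. *)
rewrite -(near_eq_derive _ near0) derive_cst DNi DT//.
rewrite metricZl metricZr NJT TT mulr0 addr0 mulr1 => /esym/eqP.
rewrite oppr_eq0 => /eqP k0.
by rewrite k0 oppr0 scale0r.
Qed.

End KahlerCurve.

Unset Implicit Arguments.
Set Strict Implicit.

Theorem proposition10 (R : realType) (n : nat) (M : manifold R (2 * n))
    (g : riemannian_metric M) (D : connection M) (J : endofield M)
    (HK : kahler g D J) (I : set R) (gam : R -> M)
    (Hgam : immersed_curve I gam) :
  let T : along gam := velocity gam in
  let JT : along gam := fun t => J (gam t) (T t) in
  [/\ (rotation_minimizing g D I JT <->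
         exists kappa1 : R -> R,
           forall t, I t -> covD D T t = kappa1 t *: JT t)
      /\ (forall kappa1 : R -> R,
            rotation_minimizing g D I JT ->
            (forall t, I t -> covD D T t = kappa1 t *: JT t) ->
            (forall t, I t -> kappa1 t = 0) ->
            geodesic D I gam),
      rotation_minimizing g D I JT ->
        forall (N : nat -> along gam) (kappa : nat -> R -> R),
          (forall t, I t -> N 1%N t = JT t) ->
          rm_frame g D I N kappa ->
          forall i t, (2 <= i < 2 * n)%N -> I t ->
            covD D (N i) t = 0 /\ kappa i t = 0
    & rotation_minimizing g D I JT ->
        exists c : R, forall t, I t ->
          Num.sqrt (g (gam t) (T t) (T t)) = c].
Proof.
move=> T JT; split.
- split; first split.
  + exact: (rotation_minimizing_J_covD HK Hgam).
  + by move=> [kappa1]; exact: (covD_rotation_minimizing_J HK Hgam).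
  + by move=> kappa1 _ DT k0 t It; rewrite DT// k0// scale0r.
- by move=> RM N kappa; exact: (rotation_minimizing_J_frame HK Hgam).
- move=> /(rotation_minimizing_J_speed HK Hgam) [c cE].
  by exists (Num.sqrt c) => t It; rewrite cE.
Qed.
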